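(* Let $\bar x\in\mathbb{R}^n$ be an AM-stationary point of the orthodisjunctive problem (ODP), and let ODP-subMFC be satisfied at $\bar x$ with $\{(x^k,\lambda^k,\delta^k,\varepsilon^k)\}_{k=1}^\infty\subset\mathbb{R}^n\times\mathbb{R}^\ell\times\mathbb{R}^\ell\times\mathbb{R}^n$ being the involved approximately M-stationary sequence w.r.t. $\bar x$. Then the following assertions hold. (a) The point $\bar x$ is M-stationary. (b) If $\{(x^k,\lambda^k,\varepsilon^k)\}_{k=1}^\infty$ is a strictly approximately S-stationary sequence w.r.t. $\bar x$, then the point $\bar x$ is S-stationary.
   Context: (ODP): $\min_x f(x)$ s.t. $F(x)\in\Gamma=\bigcup_{j=1}^t\Gamma_j$, where $f\colon\mathbb{R}^n\to\mathbb{R}$, $F\colon\mathbb{R}^n\to\mathbb{R}^\ell$ are continuously differentiable and $\Gamma_j=\prod_{i=1}^\ell[a_i^j,b_i^j]$ with $-\infty\le a_i^j\le b_i^j\le\infty$; here $[-\infty,r]=(-\infty,r]$, $[r,\infty]=[r,\infty)$ for $r\in\mathbb{R}$, and $[-\infty,\infty]=\mathbb{R}$. $[\ell]=\{1,\dots,\ell\}$; $\operatorname{sgn}\colon\mathbb{R}\to\{-1,0,1\}$ is the sign function. For a closed set $\Omega$ and $y\in\Omega$, the regular normal cone is $\widehat N_\Omega(y)=\{\xi\mid \forall z\in\Omega\colon \xi^\top(z-y)\le o(\|z-y\|)\}$; the limiting normal cone $N_\Omega(y)$ is the set of all limits of sequences $\xi^k\in\widehat N_\Omega(y^k)$ with $y^k\to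 y$, $y^k\in\Omega$. Both are $\emptyset$ for $y\notin\Omega$. For $(x,\delta)$ with $F(x)-\delta\in\Gamma$: $J(x,\delta)=\{j\in[t]\mid F(x)-\delta\in\Gamma_j\}$, $I^\exists(x,\delta)=\{i\in[\ell]\mid\exists j\in J(x,\delta)\colon F_i(x)-\delta_i\in\{a_i^j,b_i^j\}\}$, and $I^\exists(\bar x)=I^\exists(\bar x,0)$. A feasible point $\bar x$ is M-stationary (S-stationary) if there is $\lambda\in\mathbb{R}^\ell$ with $0=\nabla f(\bar x)+F'(\bar x)^\top\lambda$ and $\lambda\in N_\Gamma(F(\bar x))$ (respectively $\lambda\in\widehat N_\Gamma(F(\bar x))$). A sequence $\{(x^k,\lambda^k,\delta^k,\varepsilon^k)\}_{k=1}^\infty$ is approximately M-stationary w.r.t. the feasible point $\bar x$ if $(x^k,\delta^k,\varepsilon^k)\to(\bar x,0,0)$ and, for all $k$, $\varepsilon^k=\nabla f(x^k)+F'(x^k)^\top\lambda^k$ and $\lambda^k\in N_\Gamma(F(x^k)-\delta^k)$. $\bar x$ is AM-stationary if such a sequence exists. A sequence $\{(x^k,\lambda^k,\varepsilon^k)\}_{k=1}^\infty$ is strictly approximately S-stationary w.r.t. $\bar x$ if $(x^k,\varepsilon^k)\to(\bar x,0)$ and, for all $k$, $\varepsilon^k=\nabla f(x^k)+F'(x^k)^\top\lambda^k$ and $\lambda^k\in\widehat N_\Gamma(F(\bar x))$. Convention: passing to subsequences, all approximately M-stationary sequences considered are taken such that $J(x^k,\delta^k)$, $I^\exists(x^k,\delta^k)$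 and the signs $\operatorname{sgn}(\lambda_i^k)$, $i\in[\ell]$, do not depend on $k$. ODP-subMFC holds at an AM-stationary point $\bar x$ if there exist $I\subset I^\exists(\bar x)$ and a sequence $\{(x^k,\lambda^k,\delta^k,\varepsilon^k)\}_{k=1}^\infty$ (the ''involved'' sequence) such that: (i) either $I=\emptyset$, or for all $u\in\mathbb{R}^\ell\setminus\{0\}$ with $u\ge0$ and $u_{[\ell]\setminus I}=0$, $0\neq\sum_{i\in I}\operatorname{sgn}(\lambda_i^k)u_i\nabla F_i(\bar x)$; (ii) the sequence is approximately M-stationary w.r.t. $\bar x$, and $I=I^\exists(x^k,\delta^k)$ for all $k\in\mathbb{N}$. *)

(* Defs.v *)
From HB Require Import structures.
From mathcomp Require Import all_boot all_order all_algebra.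
From mathcomp Require Import all_classical all_reals all_analysis.
Set Implicit Arguments.
Unset Strict Implicit.
Unset Printing Implicit Defensive.
Import Order.TTheory GRing.Theory Num.Theory.
Import numFieldNormedType.Exports.
Local Open Scope ring_scope.

(* Vectors are rows throughout. *)

Definition dot (R : realType) (m : nat) (u v : 'rV[R]_m) : R :=
  \sum_(i < m) u 0 i * v 0 i.

Definition grad (R : realType) (n : nat) (f : 'rV[R]_n -> R) (x : 'rV[R]_n) :
    'rV[R]_n :=
  \row_(i < n) 'D_(delta_mx 0 i) f x.

(* The library's ['J F x] acts on row vectors from the right, v |-> v *m 'J F x,
   so it is the transpose of the usual l x n Jacobian F'(x); the row form of
   F'(x)^T lambda is therefore [lambda *m ('J F x)^T]. *)
Definition jacT_mul (R : realType) (n l : nat) (F : 'rV[R]_n -> 'rV[R]_l)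
    (x : 'rV[R]_n) (lambda : 'rV[R]_l) : 'rV[R]_n :=
  lambda *m ('J F x)^T.

Definition C1_scalar (R : realType) (n : nat) (f : 'rV[R]_n -> R) : Prop :=
  (forall x, differentiable f x) /\ continuous (grad f).

Definition C1_vector (R : realType) (n l : nat) (F : 'rV[R]_n -> 'rV[R]_l) :
    Prop :=
  (forall x, differentiable F x) /\ continuous (fun x => 'J F x).

(* The norm is the library's sup norm on row vectors; little-o does not depend
   on the choice of a norm on a finite-dimensional space. *)
Definition regular_normal_cone (R : realType) (l : nat)
    (Omega : set 'rV[R]_l) (y : 'rV[R]_l) : set 'rV[R]_l :=
  [set xi | Omega y /\
    forall e : R, 0 < e ->
      \forall z \near y, Omega z -> dot xi (z - y) <= e * `|z - y|]%classic.

Definition limiting_normal_cone (R : realType) (l : nat)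
    (Omega : set 'rV[R]_l) (y : 'rV[R]_l) : set 'rV[R]_l :=
  [set xi | Omega y /\
    exists (ys xis : nat -> 'rV[R]_l),
      [/\ forall k, Omega (ys k),
          forall k, regular_normal_cone Omega (ys k) (xis k),
          ys @ \oo --> y & xis @ \oo --> xi]]%classic.

(* The bounds may be infinite; as only real points are tested, [-oo, r] is read
   as ]-oo, r], etc. (and [+oo, +oo], [-oo, -oo] as the empty set). *)
Definition orth_box (R : realType) (l t : nat) (a b : 'I_t -> 'I_l -> \bar R)
    (j : 'I_t) : set 'rV[R]_l :=
  [set y | forall i, (a j i <= (y ord0 i)%:E <= b j i)%E]%classic.

Definition orth_union (R : realType) (l t : nat) (a b : 'I_t -> 'I_l -> \bar R) :
    set 'rV[R]_l :=
  (\bigcup_j orth_box a b j)%classic.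

Definition J_set (R : realType) (n l t : nat) (F : 'rV[R]_n -> 'rV[R]_l)
    (a b : 'I_t -> 'I_l -> \bar R) (x : 'rV[R]_n) (delta : 'rV[R]_l) :
    {set 'I_t} :=
  finset (fun j => F x - delta \in orth_box a b j).

Definition I_ex (R : realType) (n l t : nat) (F : 'rV[R]_n -> 'rV[R]_l)
    (a b : 'I_t -> 'I_l -> \bar R) (x : 'rV[R]_n) (delta : 'rV[R]_l) :
    {set 'I_l} :=
  finset (fun i => [exists j in J_set F a b x delta,
    (((F x - delta) ord0 i)%:E == a j i) || (((F x - delta) ord0 i)%:E == b j i)]).

Definition M_stationary (R : realType) (n l : nat)
    (f : 'rV[R]_n -> R) (F : 'rV[R]_n -> 'rV[R]_l) (Gamma : set 'rV[R]_l)
    (xbar : 'rV[R]_n) : Prop :=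
  Gamma (F xbar) /\
  exists lambda : 'rV[R]_l,
    0 = grad f xbar + jacT_mul F xbar lambda /\
    limiting_normal_cone Gamma (F xbar) lambda.

Definition S_stationary (R : realType) (n l : nat)
    (f : 'rV[R]_n -> R) (F : 'rV[R]_n -> 'rV[R]_l) (Gamma : set 'rV[R]_l)
    (xbar : 'rV[R]_n) : Prop :=
  Gamma (F xbar) /\
  exists lambda : 'rV[R]_l,
    0 = grad f xbar + jacT_mul F xbar lambda /\
    regular_normal_cone Gamma (F xbar) lambda.

Definition approx_M_stationary (R : realType) (n l : nat)
    (f : 'rV[R]_n -> R) (F : 'rV[R]_n -> 'rV[R]_l) (Gamma : set 'rV[R]_l)
    (xbar : 'rV[R]_n) (xs : nat -> 'rV[R]_n) (lambdas deltas : nat -> 'rV[R]_l)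
    (epss : nat -> 'rV[R]_n) : Prop :=
  [/\ (xs @ \oo --> xbar)%classic,
      (deltas @ \oo --> (0 : 'rV[R]_l))%classic,
      (epss @ \oo --> (0 : 'rV[R]_n))%classic,
      forall k, epss k = grad f (xs k) + jacT_mul F (xs k) (lambdas k) &
      forall k, limiting_normal_cone Gamma (F (xs k) - deltas k) (lambdas k)].

Definition AM_stationary (R : realType) (n l : nat)
    (f : 'rV[R]_n -> R) (F : 'rV[R]_n -> 'rV[R]_l) (Gamma : set 'rV[R]_l)
    (xbar : 'rV[R]_n) : Prop :=
  Gamma (F xbar) /\
  exists (xs : nat -> 'rV[R]_n) (lambdas deltas : nat -> 'rV[R]_l)
    (epss : nat -> 'rV[R]_n),
    approx_M_stationary f F Gamma xbar xs lambdas deltas epss.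

Definition strictly_approx_S_stationary (R : realType) (n l : nat)
    (f : 'rV[R]_n -> R) (F : 'rV[R]_n -> 'rV[R]_l) (Gamma : set 'rV[R]_l)
    (xbar : 'rV[R]_n) (xs : nat -> 'rV[R]_n) (lambdas : nat -> 'rV[R]_l)
    (epss : nat -> 'rV[R]_n) : Prop :=
  [/\ (xs @ \oo --> xbar)%classic,
      (epss @ \oo --> (0 : 'rV[R]_n))%classic,
      forall k, epss k = grad f (xs k) + jacT_mul F (xs k) (lambdas k) &
      forall k, regular_normal_cone Gamma (F xbar) (lambdas k)].

(* The standing convention on approximately M-stationary sequences, which can
   always be reached by passing to a subsequence. *)
Definition constant_pattern (R : realType) (n l t : nat)
    (F : 'rV[R]_n -> 'rV[R]_l) (a b : 'I_t -> 'I_l -> \bar R)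
    (xs : nat -> 'rV[R]_n) (lambdas deltas : nat -> 'rV[R]_l) : Prop :=
  [/\ forall k m, J_set F a b (xs k) (deltas k) = J_set F a b (xs m) (deltas m),
      forall k m, I_ex F a b (xs k) (deltas k) = I_ex F a b (xs m) (deltas m) &
      forall k m i, Num.sg (lambdas k ord0 i) = Num.sg (lambdas m ord0 i)].

(* ODP-subMFC at [xbar], with the involved sequence made explicit. Under
   [constant_pattern] the signs of [lambdas k] do not depend on [k], so the
   quantifier over [k] in the second condition is immaterial. *)
Definition ODP_subMFC_with (R : realType) (n l t : nat)
    (f : 'rV[R]_n -> R) (F : 'rV[R]_n -> 'rV[R]_l)
    (a b : 'I_t -> 'I_l -> \bar R) (xbar : 'rV[R]_n)
    (xs : nat -> 'rV[R]_n) (lambdas deltas : nat -> 'rV[R]_l)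
    (epss : nat -> 'rV[R]_n) : Prop :=
  exists I : {set 'I_l},
  [/\ I \subset I_ex F a b xbar 0,
      I = finset.set0 \/
      (forall (k : nat) (u : 'rV[R]_l),
          u <> 0 -> (forall i, 0 <= u ord0 i) ->
          (forall i, i \notin I -> u ord0 i = 0) ->
          0 <> \sum_(i in I) (Num.sg (lambdas k ord0 i) * u ord0 i)
                 *: grad (fun x => F x ord0 i) xbar),
      approx_M_stationary f F (orth_union a b) xbar xs lambdas deltas epss,
      constant_pattern F a b xs lambdas deltas &
      forall k, I = I_ex F a b (xs k) (deltas k)].

(* Main.v *)
Require Import Defs.
From mathcomp Require Import all_boot all_order all_algebra.
From mathcomp Require Import all_classical all_reals all_analysis.
From mathcomp Require Import ring lra.
Import Order.TTheory GRing.Theory Num.Theory.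
Import numFieldNormedType.Exports.
Local Open Scope ring_scope.
Set Implicit Arguments.
Unset Strict Implicit.
Unset Printing Implicit Defensive.

(** The whole theorem reduces to one claim: along some filter finer than the
    tail filter of nat, the multipliers [lambdas k] converge. Given a limit
    [lambda], the equations [epss k = grad f (xs k) + F'(xs k)^T lambdas k]
    pass to the limit because [f] and [F] are C1, and so do the memberships:
    the graph of the limiting normal cone is closed, which gives (a), and the
    regular normal cone at the fixed point [F xbar] is closed, which gives (b).

    Convergence comes from homogenization. Scale the multipliers to
    [mu k = tau k *: lambdas k] with [tau k = (1 + |lambdas k|)^-1], so that
    [|mu k| + tau k = 1]. Everything is now bounded, hence converges along an
    ultrafilter, to [mu0] and [tau0] with [|mu0| + tau0 = 1]. If [tau0 != 0],
    then [lambdas k = (tau k)^-1 *: mu k] converges. If [tau0 = 0], then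
    [mu0 != 0] while the scaled equations give [F'(xbar)^T mu0 = 0]. The signs
    of the entries of [mu0] are those of the multipliers, up to vanishing, and
    [mu0] vanishes outside the active set [I], so [u_i = |mu0_i|] violates the
    constraint qualification (if [I] is empty, [mu0 = 0] already).

    That multipliers vanish outside the active set is local geometry of the
    union of boxes ([limiting_normal_inactive]): near the base point, every box
    containing a nearby point [z] also contains the base point and hence has
    [z] strictly between its bounds in an inactive coordinate. One can move
    both ways along that coordinate without leaving the union, which forces the
    corresponding entry of every regular normal to be zero.

    Ultrafilters replace the extraction of successive subsequences. *)

(** * Norm and convergence of row vectors *)

Lemma entry_le_norm (R : realType) (l : nat) (u : 'rV[R]_l) (i : 'I_l) :
  `|u ord0 i| <= `|u|.
Proof.
rewrite [X in _ <= X]/Num.norm/= mx_normrE.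
exact: (le_bigmax _ (fun ij : 'I_1 * 'I_l => `|u ij.1 ij.2|) (ord0, i)).
Qed.

Lemma norm_dot_le (R : realType) (l : nat) (u v : 'rV[R]_l) :
  `|dot u v| <= l%:R * (`|u| * `|v|).
Proof.
apply: (le_trans (ler_norm_sum _ _ _)).
have -> : l%:R * (`|u| * `|v|) = \sum_(i < l) `|u| * `|v|.
  by rewrite sumr_const card_ord mulr_natl.
by apply: ler_sum => i _; rewrite normrM ler_pM// entry_le_norm.
Qed.

Lemma cvg_entry (R : realType) (m p : nat) (T : Type) (G : set_system T)
    (v : T -> 'M[R]_(m, p)) (w : 'M[R]_(m, p)) (i : 'I_m) (k : 'I_p) :
  Filter G -> (v @ G --> w)%classic ->
  ((fun t => v t i k) @ G --> w i k)%classic.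
Proof. by move=> GF; exact: continuous_cvg (@coord_continuous R m p i k w). Qed.

Lemma ultra_fmap (T U : Type) (f : T -> U) (G : set_system T) :
  UltraFilter G -> UltraFilter (f @ G)%classic.
Proof.
move=> GU; split=> [|H HP fGH]; first exact: fmap_proper_filter.
apply/seteqP; split=> // A HA.
have [//|GnA] := in_ultra_setVsetC (f @^-1` A)%classic GU.
have /filter_ex[u []] : H (A `&` ~` A)%classic.
  by apply: filterI => //; exact: fGH.
by [].
Qed.

Lemma ultra_bounded_cvg (R : realType) (l : nat) (T : Type)
    (G : set_system T) (u : T -> 'rV[R]_l) :
  UltraFilter G -> (forall t, `|u t| <= 1) ->
  exists v : 'rV[R]_l, (u @ G --> v)%classic.
Proof.
move=> GU u1.
have := @rV_compact R l (fun _ => `[-1, 1]%classic)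
  (fun _ => @segment_compact R (-1) 1).
rewrite compact_ultra => /(_ _ (ultra_fmap u GU))[|v [_ uv]]; last by exists v.
apply: (@filterE _ G) => t i /=; rewrite in_itv/= -ler_norml.
exact: le_trans (entry_le_norm _ _) (u1 t).
Qed.

(** * Closedness of the normal cones *)

(** A closure point [xi] has a regular normal [w] within [e / (2 (l + 1))];
    passing from [w] to [xi] costs at most [e / 2 * |z - y|] on the tested
    displacement, the factor [l] coming from the sup norm. *)
Lemma closed_regular_normal_cone (R : realType) (l : nat)
    (Omega : set 'rV[R]_l) (y : 'rV[R]_l) :
  closed (regular_normal_cone Omega y).
Proof.
move=> xi clxi.
have [_ [[Oy _] _]] := clxi _ (nbhsx_ballx xi 1 ltr01).
split=> // e e0.
have d0 : 0 < e / 2 / l.+1%:R by rewrite !divr_gt0.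
have [w [[_ regw]]] := clxi _ (nbhsx_ballx xi _ d0).
rewrite -ball_normE/= => xiw.
have e20 : 0 < e / 2 by rewrite divr_gt0.
apply: filterS (regw _ e20) => z wz Oz.
have -> : dot xi (z - y) = dot (xi - w) (z - y) + dot w (z - y).
  by rewrite /dot -big_split/=; apply: eq_bigr => i _; rewrite !mxE; ring.
rewrite [e in leRHS](splitr e) mulrDl lerD ?wz//.
apply: le_trans (ler_norm _) _.
apply: le_trans (norm_dot_le _ _) _.
rewrite mulrA ler_wpM2r//.
move: xiw; rewrite ltr_pdivlMr ?ltr0n// mulrC => /ltW; apply: le_trans.
by rewrite ler_wpM2r// ler_nat.
Qed.

(** Closedness of the graph, by a diagonal argument: for each [m] one picks a
    limiting normal close to [w0] and then, in the sequence defining it, a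
    regular normal at a point close to [y0]. The filter is arbitrary, yet the
    witnesses form a genuine sequence. *)
Lemma limiting_normal_cone_cvg (R : realType) (l : nat)
    (Omega : set 'rV[R]_l) (T : Type) (G : set_system T) (GG : ProperFilter G)
    (y w : T -> 'rV[R]_l) (y0 w0 : 'rV[R]_l) :
  Omega y0 -> (forall t, limiting_normal_cone Omega (y t) (w t)) ->
  (y @ G --> y0)%classic -> (w @ G --> w0)%classic ->
  limiting_normal_cone Omega y0 w0.
Proof.
move=> Oy0 limw yy0 ww0; split=> //.
have approx (m : nat) : exists p : 'rV[R]_l * 'rV[R]_l,
    [/\ Omega p.1, regular_normal_cone Omega p.1 p.2,
     `|y0 - p.1| < m.+1%:R^-1 & `|w0 - p.2| < m.+1%:R^-1].
  have e0 : 0 < m.+1%:R^-1 / 2 :> R by rewrite divr_gt0// invr_gt0 ltr0n.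
  have /filter_ex[t [yt wt]] : \forall t \near G,
      `|y0 - y t| < m.+1%:R^-1 / 2 /\ `|w0 - w t| < m.+1%:R^-1 / 2.
    by apply: filterI;
      [exact: cvgr_dist_lt yy0 _ e0|exact: cvgr_dist_lt ww0 _ e0].
  have [_ [ys [xis [Oys regs ysy xisw]]]] := limw t.
  have /filter_ex[k [yk wk]] : \forall k \near \oo%classic,
      `|y t - ys k| < m.+1%:R^-1 / 2 /\ `|w t - xis k| < m.+1%:R^-1 / 2.
    by apply: filterI;
      [exact: cvgr_dist_lt ysy _ e0|exact: cvgr_dist_lt xisw _ e0].
  by exists (ys k, xis k); split=> //=; rewrite (splitr m.+1%:R^-1);
    apply: le_lt_trans (ler_distD _ _ _) (ltrD _ _); eassumption.
have harmonic_cvg (u : nat -> 'rV[R]_l) (v : 'rV[R]_l) :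
    (forall m, `|v - u m| < m.+1%:R^-1) -> (u @ \oo --> v)%classic.
  move=> uv; apply/cvgrPdist_lt => e e0.
  apply: filterS (cvgr_dist_lt _ _ (@cvg_harmonic R) _ e0) => m.
  rewrite sub0r normrN ger0_norm ?harmonic_ge0//.
  exact: lt_trans (uv m).
have [p Hp] := choice approx.
exists (fun m => (p m).1), (fun m => (p m).2); split.
- by move=> k; case: (Hp k).
- by move=> k; case: (Hp k).
- by apply: harmonic_cvg => k; case: (Hp k).
- by apply: harmonic_cvg => k; case: (Hp k).
Qed.

(** * Normals to a union of boxes *)

(** Moving by a step of size [r / 2] in the direction of the sign of [xi_i]
    changes [dot xi] by [|xi_i| * r / 2], which is not [o(r)] unless
    [xi_i = 0]. *)
Lemma regular_normal_free_coord (R : realType) (l : nat)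
    (Omega : set 'rV[R]_l) (z xi : 'rV[R]_l) (i : 'I_l) :
  regular_normal_cone Omega z xi ->
  (\forall s \near (0 : R), Omega (z + s *: delta_mx 0 i)) ->
  xi ord0 i = 0.
Proof.
move=> [_ regxi] free; apply/eqP/negPn/negP => xii0.
set d : 'rV[R]_l := delta_mx 0 i.
(* The slope is chosen so that the little-o bound reads |d| + 1 <= |d|. *)
have e0 : 0 < `|xi ord0 i| / (`|d| + 1).
  by rewrite divr_gt0 ?normr_gt0// ltr_wpDl.
have cz : ((fun s : R => z + s *: d) @ (0 : R) --> z)%classic.
  rewrite -[X in (_ --> X)%classic]addr0 -(scale0r d).
  by apply: cvgD; [exact: cvg_cst|apply: cvgZl; exact: cvg_id].
have /(_ _)/nbhs_ballP[r /= r0 rP] := filterI free (cz _ (regxi _ e0)).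
have r2 : 0 < r / 2 by rewrite divr_gt0.
have nsg : `|Num.sg (xi ord0 i) * (r / 2)| = r / 2.
  by rewrite normrM normr_sg xii0 mul1r gtr0_norm.
have [|Os /(_ Os) +] := rP (Num.sg (xi ord0 i) * (r / 2)).
  rewrite -ball_normE/= sub0r normrN nsg; lra.
rewrite addrC addKr normrZ nsg.
have -> : dot xi ((Num.sg (xi ord0 i) * (r / 2)) *: d) =
    `|xi ord0 i| * (r / 2).
  rewrite /dot (bigD1 i)//= big1 ?addr0 => [|j ji].
    by rewrite !mxE !eqxx mulr1 mulrA [_ * Num.sg _]mulrC -normrEsg.
  by rewrite !mxE (negbTE ji) !mulr0.
rewrite -[leRHS]mulrA ler_pM2l ?normr_gt0// ler_pdivlMl ?ltr_wpDl//.
by rewrite [leRHS]mulrC ler_pM2r// gerDl ler10.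
Qed.

(** There are finitely many boxes: those missing [y] are closed and miss a
    neighbourhood of [y], and for the others strict inequalities persist. *)
Lemma near_orth_box_interior (R : realType) (l t : nat)
    (a b : 'I_t -> 'I_l -> \bar R) (y : 'rV[R]_l) (i : 'I_l) :
  (forall j, orth_box a b j y -> (a j i < (y ord0 i)%:E < b j i)%E) ->
  \forall z \near y, forall j, orth_box a b j z ->
    (a j i < (z ord0 i)%:E < b j i)%E.
Proof.
move=> inty.
apply: (@filter_forall _ _ (fun j z => orth_box a b j z ->
  (a j i < (z ord0 i)%:E < b j i)%E) (nbhs y) _) => j.
have ltP (c : \bar R) k : (c < (y ord0 k)%:E)%E ->
    \forall z \near y, (c < ((z : 'rV[R]_l) ord0 k)%:E)%E.
  move=> cy.
  apply: (@coord_continuous R 1 l ord0 k y [set r | (c < r%:E)%E]%classic).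
  by apply: open_nbhs_nbhs; split; [exact: open_ereal_gt|].
have gtP (c : \bar R) k : ((y ord0 k)%:E < c)%E ->
    \forall z \near y, (((z : 'rV[R]_l) ord0 k)%:E < c)%E.
  move=> cy.
  apply: (@coord_continuous R 1 l ord0 k y [set r | (r%:E < c)%E]%classic).
  by apply: open_nbhs_nbhs; split; [exact: open_ereal_lt|].
have [yj|] := pselect (orth_box a b j y).
  have /andP[ay yb] := inty _ yj.
  by apply: filterS2 (ltP _ _ ay) (gtP _ _ yb) => z -> ->.
move=> /existsNP[k] /negP; rewrite negb_and -!ltNge => /orP[ya|by_].
- by apply: filterS (gtP _ _ ya) => z za /(_ k); rewrite leNgt za.
- by apply: filterS (ltP _ _ by_) => z bz /(_ k);
    rewrite [X in _ && X]leNgt bz andbF.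
Qed.

(** One box containing [z] suffices, the other coordinates being unchanged. *)
Lemma orth_union_free_coord (R : realType) (l t : nat)
    (a b : 'I_t -> 'I_l -> \bar R) (z : 'rV[R]_l) (i : 'I_l) :
  orth_union a b z ->
  (forall j, orth_box a b j z -> (a j i < (z ord0 i)%:E < b j i)%E) ->
  \forall s \near (0 : R), orth_union a b (z + s *: delta_mx 0 i).
Proof.
move=> [j _ zj] /(_ _ zj) /andP[az zb].
have zs : ((fun s : R => z ord0 i + s) @ (0 : R) --> z ord0 i)%classic.
  rewrite -[X in (_ --> X)%classic]addr0.
  by apply: cvgD; [exact: cvg_cst|exact: cvg_id].
have near0 : \forall s \near (0 : R),
    (a j i < (z ord0 i + s)%:E)%E /\ ((z ord0 i + s)%:E < b j i)%E.
  exact: zs _ (nbhs_interval az zb (fun y => @conj _ _)).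
apply: filterS near0 => s [/ltW as_ /ltW sb]; exists j => // k.
rewrite !mxE eqxx/=; have [->|_] := eqVneq k i; first by rewrite mulr1 as_ sb.
by rewrite mulr0 addr0; exact: zj.
Qed.

(** Inactivity of coordinate [i] at [y] persists at the nearby points whose
    regular normals define [xi]; their [i]-th entries vanish, hence so does the
    limit's. *)
Lemma limiting_normal_orth_union_free (R : realType) (l t : nat)
    (a b : 'I_t -> 'I_l -> \bar R) (y xi : 'rV[R]_l) (i : 'I_l) :
  limiting_normal_cone (orth_union a b) y xi ->
  (forall j, orth_box a b j y -> (a j i < (y ord0 i)%:E < b j i)%E) ->
  xi ord0 i = 0.
Proof.
move=> [_ [ys [xis [Oys regs ysy xisxi]]]] inty.
have cl0 : closed (fun v : 'rV[R]_l => v ord0 i = 0).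
  apply: (@closed_comp _ _ (fun v : 'rV[R]_l => v ord0 i) [set 0]%classic).
    by move=> v _; exact: coord_continuous.
  exact: closed_eq.
apply: (closed_cvg _ cl0 _ _ xisxi).
have neark : \forall k \near \oo%classic, forall j, orth_box a b j (ys k) ->
    (a j i < (ys k ord0 i)%:E < b j i)%E.
  exact: ysy _ (near_orth_box_interior inty).
apply: filterS neark => k intk.
exact: regular_normal_free_coord (regs k) (orth_union_free_coord (Oys k) intk).
Qed.

(** The multipliers of the problem are supported on the active set
    [I_ex F a b x delta], the form in which the constraint qualification can use
    the previous lemma. *)
Lemma limiting_normal_inactive (R : realType) (n l t : nat)
    (F : 'rV[R]_n -> 'rV[R]_l) (a b : 'I_t -> 'I_l -> \bar R)
    (x : 'rV[R]_n) (delta xi : 'rV[R]_l) (i : 'I_l) :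
  limiting_normal_cone (orth_union a b) (F x - delta) xi ->
  i \notin I_ex F a b x delta -> xi ord0 i = 0.
Proof.
move=> limxi; rewrite inE => /existsPn inact.
apply: (limiting_normal_orth_union_free limxi) => j yj.
have := inact j; rewrite inE (mem_set yj)/= negb_or => /andP[ya yb].
by have /andP[ay yb'] := yj i; rewrite !lt_neqAle ay yb yb' eq_sym ya.
Qed.

(** * Passage to the limit in the stationarity equations *)

(** Connects the matrix form of the equations with the combinations of
    gradients that occur in the constraint qualification. *)
Lemma jacT_mulE (R : realType) (n l : nat) (F : 'rV[R]_n -> 'rV[R]_l)
    (x : 'rV[R]_n) (u : 'rV[R]_l) : differentiable F x ->
  jacT_mul F x u = \sum_i u ord0 i *: grad (fun z => F z ord0 i) x.
Proof.
move=> dF; apply/rowP => j; rewrite /jacT_mul mxE summxE.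
apply: eq_bigr => i _; rewrite !mxE; congr (_ * _).
have := deriveEjacobian (delta_mx 0 j) dF.
rewrite derive_mx; last exact: diff_derivable.
by rewrite -rowE => /matrixP/(_ ord0 i); rewrite !mxE.
Qed.

(** The scalar weight [tau] on [f] serves both the original equations
    ([tau = 1]) and the homogenized ones. *)
Lemma cvg_lagrangian_grad (R : realType) (n l : nat)
    (f : 'rV[R]_n -> R) (F : 'rV[R]_n -> 'rV[R]_l) (T : Type)
    (G : set_system T) (x : T -> 'rV[R]_n) (tau : T -> R) (mu : T -> 'rV[R]_l)
    (x0 : 'rV[R]_n) (tau0 : R) (mu0 : 'rV[R]_l) (j : 'I_n) :
  Filter G -> C1_scalar f -> C1_vector F ->
  (x @ G --> x0)%classic -> (tau @ G --> tau0)%classic ->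
  (mu @ G --> mu0)%classic ->
  ((fun k => (tau k *: grad f (x k) + jacT_mul F (x k) (mu k)) ord0 j) @ G -->
   (tau0 *: grad f x0 + jacT_mul F x0 mu0) ord0 j)%classic.
Proof.
move=> GF [_ cf] [_ cF] xx0 tautau0 mumu0.
have lagE (c : R) z v : (c *: grad f z + jacT_mul F z v) ord0 j =
    c * grad f z ord0 j + \sum_i v ord0 i * ('J F z) j i.
  rewrite /jacT_mul; set A := ('J F z)%R; set g := grad f z.
  rewrite mxE; congr (_ + _); first by rewrite mxE.
  by rewrite mxE; apply: eq_bigr => i _; congr (_ * _); rewrite mxE.
have cvg_eq (g g' : T -> R) (y y' : R) :
    (forall k, g k = g' k) -> y = y' ->
    (g' @ G --> y')%classic -> (g @ G --> y)%classic.
  by move=> /funext-> ->.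
apply: (cvg_eq _ _ _ _ (fun k => lagE (tau k) (x k) (mu k)) (lagE tau0 x0 mu0)).
apply: cvgD.
  apply: cvgM => //; apply: (@cvg_entry _ _ _ _ _ (fun k => grad f (x k))).
  exact: (continuous_cvg _ (cf x0) xx0).
apply: (cvg_big add_continuous) => i _.
apply: cvgM; first exact: cvg_entry.
apply: (@cvg_entry _ _ _ _ _ (fun k => 'J F (x k))).
exact: (continuous_cvg _ (cF x0) xx0).
Qed.

(** * Convergence of the multipliers and the main theorem *)

(** The homogenization argument: the constraint qualification excludes a limit
    with vanishing weight on the objective. *)
Lemma subMFC_multipliers_cvg (R : realType) (n l t : nat)
    (f : 'rV[R]_n -> R) (F : 'rV[R]_n -> 'rV[R]_l)
    (a b : 'I_t -> 'I_l -> \bar R) (xbar : 'rV[R]_n)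
    (xs : nat -> 'rV[R]_n) (lambdas deltas : nat -> 'rV[R]_l)
    (epss : nat -> 'rV[R]_n) :
  C1_scalar f -> C1_vector F ->
  ODP_subMFC_with f F a b xbar xs lambdas deltas epss ->
  exists (G : set_system nat) (lambda : 'rV[R]_l),
    [/\ ProperFilter G, (G --> \oo)%classic &
      (lambdas @ G --> lambda)%classic].
Proof.
move=> hf hF [I [_ mfc [xsx _ eps0 epsE limlam] [_ _ sgE] IE]].
have [G [GU ooG]] := ultraFilterLemma (@eventually_filter).
have GP : ProperFilter G by exact: ultra_proper.
pose tau k := (1 + `|lambdas k|)^-1.
pose mu k := tau k *: lambdas k.
have den_gt0 k : 0 < 1 + `|lambdas k| by rewrite ltr_pwDl.
have tau_gt0 k : 0 < tau k by rewrite invr_gt0.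
have mutau k : `|mu k| + tau k = 1.
  by rewrite normrZ gtr0_norm// -{2}[tau k]mulr1 -mulrDr addrC mulVf// gt_eqF.
have mu_le1 k : `|mu k| <= 1 by rewrite -(mutau k) lerDl ltW.
have tau_le1 k : tau k <= 1 by rewrite -(mutau k) lerDr.
have [mu0 mumu0] := ultra_bounded_cvg GU mu_le1.
have [tau0 tautau0] : exists tau0 : R, (tau @ G --> tau0)%classic.
  have := @segment_compact R 0 1.
  rewrite compact_ultra => /(_ _ (ultra_fmap tau GU))[|v [_ tauv]];
    last by exists v.
  by apply: (@filterE _ G) => k; rewrite /= in_itv/= tau_le1 ltW.
exists G, (tau0^-1 *: mu0); split; [exact: GP|exact: ooG|].
have lamE k : lambdas k = (tau k)^-1 *: mu k.
  by rewrite scalerA mulVf ?scale1r// gt_eqF.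
suff tau0_neq0 : tau0 != 0.
  rewrite (funext lamE).
  apply: cvgZ => //.
  exact: cvgV.
apply/eqP => tau00.
have nmu0 : `|mu0| = 1.
  have h : ((fun k => `|mu k| + tau k) @ G --> `|mu0|)%classic.
    by rewrite -[`|mu0|]addr0 -tau00; exact: cvgD (cvg_norm mumu0) tautau0.
  apply: (cvg_unique (@norm_hausdorff _ _) h) => /=.
  by rewrite (eq_cvg _ _ mutau); exact: cvg_cst.
have mu0_neq0 : mu0 <> 0.
  by move=> mu00; move: nmu0; rewrite mu00 normr0 => /esym/eqP; rewrite oner_eq0.
have closed_entry (i : 'I_l) (A : set R) : closed A ->
    (forall k, A (mu k ord0 i)) -> A (mu0 ord0 i).
  move=> cA Amu.
  have cAi : closed (fun v : 'rV[R]_l => A (v ord0 i)).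
    apply: (@closed_comp _ _ (fun v : 'rV[R]_l => v ord0 i) A) => // v _.
    exact: coord_continuous.
  by apply: (closed_cvg _ cAi _ _ mumu0); exact: filterE.
have mu0_supp i : i \notin I -> mu0 ord0 i = 0.
  move=> iI; apply: (closed_entry i [set 0]%classic); first exact: closed_eq.
  move=> k; rewrite /= mxE (limiting_normal_inactive (limlam k)) ?mulr0//.
  by rewrite -IE.
have mu0_sg i : mu0 ord0 i = Num.sg (lambdas 0%N ord0 i) * `|mu0 ord0 i|.
  have mui := cvg_entry (i := ord0) (k := i) GP mumu0.
  apply: (cvg_unique (@norm_hausdorff _ _) mui) => /=.
  have sgmu k : mu k ord0 i = Num.sg (lambdas 0%N ord0 i) * `|mu k ord0 i|.
    by rewrite /= mxE normrM gtr0_norm// mulrCA (sgE 0%N k) -numEsg.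
  by rewrite (eq_cvg _ _ sgmu); apply: cvgMr; apply: cvg_norm.
have dFx : differentiable F xbar by case: hF.
have lag0 : jacT_mul F xbar mu0 = 0.
  apply/rowP => j; rewrite [RHS]mxE.
  have h := cvg_lagrangian_grad (j := j) GP hf hF (cvg_trans (cvg_app xs ooG) xsx)
    tautau0 mumu0.
  rewrite tau00 scale0r add0r in h.
  have taueps k : (tau k *: grad f (xs k) + jacT_mul F (xs k) (mu k)) ord0 j =
      tau k * epss k ord0 j.
    by rewrite /jacT_mul /mu -scalemxAl -scalerDr epsE [LHS]mxE.
  rewrite (eq_cvg _ _ taueps) in h.
  have epsj := cvg_entry (i := ord0) (k := j) GP
    (cvg_trans (cvg_app epss ooG) eps0).
  (* The left-hand sides tau k *: epss k of the scaled equations tend to 0. *)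
  rewrite [RHS](_ : 0 = tau0 * (0 : 'rV[R]_n) ord0 j);
    last by rewrite tau00 mul0r.
  by apply: (cvg_unique (@norm_hausdorff _ _) h); exact: cvgM tautau0 epsj.
case: mfc => [I0|/(_ 0%N (\row_i `|mu0 ord0 i|))].
  by apply: mu0_neq0; apply/rowP => i; rewrite mu0_supp ?mxE// I0 inE.
apply.
- move/rowP => nmu; apply: mu0_neq0; apply/rowP => i.
  by have := nmu i; rewrite !mxE => /eqP; rewrite normr_eq0 => /eqP.
- by move=> i; rewrite mxE.
- by move=> i /mu0_supp mui; rewrite mxE mui normr0.
- rewrite -[LHS]lag0 jacT_mulE// [LHS](bigID (mem I))/= [X in _ + X]big1 ?addr0.
    by apply: eq_bigr => i _; rewrite mxE -mu0_sg.
  by move=> i /mu0_supp ->; rewrite scale0r.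
Qed.

Theorem theorem4p5 (R : realType) (n l t : nat)
    (f : 'rV[R]_n -> R) (F : 'rV[R]_n -> 'rV[R]_l)
    (a b : 'I_t -> 'I_l -> \bar R)
    (hf : C1_scalar f) (hF : C1_vector F)
    (hab : forall j i, (a j i <= b j i)%E)
    (xbar : 'rV[R]_n)
    (hAM : AM_stationary f F (orth_union a b) xbar)
    (xs : nat -> 'rV[R]_n) (lambdas deltas : nat -> 'rV[R]_l)
    (epss : nat -> 'rV[R]_n)
    (hMFC : ODP_subMFC_with f F a b xbar xs lambdas deltas epss) :
  M_stationary f F (orth_union a b) xbar /\
  (strictly_approx_S_stationary f F (orth_union a b) xbar xs lambdas epss ->
   S_stationary f F (orth_union a b) xbar).
Proof.
have [Gamx _] := hAM.
have [G [lambda [GP ooG lamG]]] := subMFC_multipliers_cvg hf hF hMFC.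
have [I [_ _ [xsx delta0 eps0 epsE limlam] _ _]] := hMFC.
have xsG := cvg_trans (cvg_app xs ooG) xsx.
have stat : 0 = grad f xbar + jacT_mul F xbar lambda.
  rewrite -[grad f xbar]scale1r; apply/rowP => j.
  have one1 : ((fun _ : nat => 1 : R) @ G --> (1 : R))%classic by exact: cvg_cst.
  have h := cvg_lagrangian_grad (j := j) GP hf hF xsG one1 lamG.
  have epsjE k : (1 *: grad f (xs k) + jacT_mul F (xs k) (lambdas k)) ord0 j =
      epss k ord0 j.
    by rewrite scale1r epsE.
  rewrite (eq_cvg _ _ epsjE) in h.
  apply: (cvg_unique (@norm_hausdorff _ _) _ h).
  exact: cvg_entry (cvg_trans (cvg_app epss ooG) eps0).
split; [split=> //|move=> [_ _ _ reglam]; split=> //]; exists lambda; split=> //.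
- apply: (limiting_normal_cone_cvg _ _ limlam _ lamG) => //.
  rewrite -[F xbar]subr0; apply: cvgB;
    last exact: cvg_trans (cvg_app _ ooG) delta0.
  have [dF _] := hF.
  exact: (continuous_cvg _ (differentiable_continuous (dF xbar)) xsG).
- by apply: (closed_cvg _ (@closed_regular_normal_cone _ _ _ _) _ _ lamG);
    exact: filterE.
Qed.
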